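(* Let $k \ge 2$ be an integer and let $G \in \mathcal{G}_1$ be a graph of order $n$ with minimum degree $\delta \ge 2k+2$. If \[ \mu_{n-2}(G) > \frac{16\left(k+\frac{\delta-1}{\delta}\right)}{3(\delta+1)}, \] then $G$ has property $P(k, \delta)$.
   Context: All graphs are finite, undirected and simple. For a graph $G$ with vertex set $V(G)$, $|V(G)|=n$, let $A(G)$ be its adjacency matrix, $D(G)$ the diagonal matrix of vertex degrees, and $L(G)=D(G)-A(G)$ its Laplacian matrix. $\mu_i(G)$ denotes the $i$-th largest eigenvalue of $L(G)$ (counted with multiplicity), so $\mu_1(G)\ge\mu_2(G)\ge\cdots\ge\mu_n(G)$ and $\mu_{n-2}(G)$ is the third smallest Laplacian eigenvalue. For disjoint $X,Y\subseteq V(G)$, $e(X,Y)$ is the number of edges of $G$ with one endpoint in $X$ and the other in $Y$. $\kappa'(G)$ is the edge connectivity of $G$. For a positive integer $t$, $\mathcal{G}_t$ is the set of simple graphs $G$ that contain at least $t+1$ non-empty pairwise disjoint proper subsets $V_1,\ldots,V_{t+1}$ of $V(G)$ such that $V(G)\setminus\bigcup_{i=1}^{t+1}V_i\neq\emptyset$ and $\kappa'(G)=e(V_i,V(G)\setminus V_i)$ for every $i=1,\ldots,t+1$. For positive integers $k,d$, a graph $G$ of order $n$ has property $P(k,d)$ if: (a) $G$ contains $k$ pairwise edge-disjoint spanning trees; (b) apart from these $k$ edge-disjoint spanning trees (i.e. edge-disjoint from them), there exists another forest $F$ in $G$ with number of edges $|E(F)|>\frac{d-1}{d}(n-1)$;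 and (c) if $F$ is not a spanning tree of $G$, then $F$ has a component with at least $d$ edges. *)

(* Defs.v *)
From HB Require Import structures.
From mathcomp Require Import all_boot all_order all_algebra.
From mathcomp Require Import polyrcf.

Set Implicit Arguments.
Unset Strict Implicit.
Unset Printing Implicit Defensive.

Import Order.TTheory GRing.Theory Num.Theory.

(* A finite simple graph is a finType T of vertices with a symmetric and
   irreflexive adjacency relation e : rel T. An edge is the unordered pair
   [set x; y] of its endpoints. A subgraph is represented by its edge set F, and
   is regarded as a spanning subgraph (every vertex of T belongs to it). *)

Section EdgeSets.

Variable T : finType.
Implicit Types (F : {set {set T}}) (X Y : {set T}).

Definition adj_of F : rel T := [rel x y | (x != y) && ([set x; y] \in F)].

Definition connected_by F : bool :=
  [forall x, forall y, connect (adj_of F) x y].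

Definition is_forest F : Prop :=
  forall c : seq T, 2 < size c -> ~ ucycle (adj_of F) c.

Definition is_spanning_tree F : Prop := connected_by F /\ is_forest F.

Definition component_edges F (x : T) : {set {set T}} :=
  [set f in F | f \subset [set y | connect (adj_of F) x y]].

End EdgeSets.

Section Graphs.

Variables (T : finType) (e : rel T).
Implicit Types (F : {set {set T}}) (X Y : {set T}).

Definition edges_between X Y : {set {set T}} :=
  [set [set x; y] | x in X, y in Y & e x y].

Definition edges : {set {set T}} := edges_between setT setT.

Definition degree (x : T) : nat := #|[set y | e x y]|.

(* Every degree is at most #|T|, so the default value #|T| is harmless. *)
Definition min_degree : nat := \big[minn/#|T|]_(x : T) degree x.

Definition edge_cut F : bool :=
  (F \subset edges) && ~~ connected_by (edges :\: F).

(* With at least two vertices, [edges] itself is an edge cut; with at most one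
   vertex there is no edge cut, and the default value [edges] is empty, giving
   the usual convention that the edge connectivity is then 0. *)
Definition edge_connectivity : nat :=
  #|[arg min_(F < edges | edge_cut F) #|F|]|.

Definition in_G (t : nat) : Prop :=
  exists V : 'I_t.+1 -> {set T},
    [/\ forall i, V i != set0 /\ V i \proper [set: T],
        forall i j, i != j -> [disjoint V i & V j],
        ~: (\bigcup_i V i) != set0
      & forall i, edge_connectivity = #|edges_between (V i) (~: V i)|].

Definition property_P (k d : nat) : Prop :=
  exists (S : 'I_k -> {set {set T}}) (F : {set {set T}}),
    [/\ forall i, S i \subset edges /\ is_spanning_tree (S i),
        forall i j, i != j -> [disjoint S i & S j],
        [/\ F \subset edges, is_forest F,
            forall i, [disjoint F & S i]
          & ((d%:R - 1) / d%:R * (#|T|%:R - 1) < #|F|%:R :> rat)%R]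
      & ~ is_spanning_tree F -> exists x : T, d <= #|component_edges F x|].

End Graphs.

Section Laplacian.

Variables (R : rcfType) (T : finType) (e : rel T).

Local Open Scope ring_scope.

Definition adjacency_matrix : 'M[R]_#|T| :=
  \matrix_(i, j) (e (enum_val i) (enum_val j))%:R.

Definition degree_matrix : 'M[R]_#|T| :=
  diag_mx (\row_i (degree e (enum_val i))%:R).

Definition laplacian : 'M[R]_#|T| := degree_matrix - adjacency_matrix.

(* The roots of the characteristic polynomial, each repeated according to its
   multiplicity, in nonincreasing order. *)
Definition laplacian_spectrum : seq R :=
  let p := char_poly laplacian in
  sort >=%R (flatten [seq nseq (mup x p) x | x <- rootsR p]).

(* The i-th largest eigenvalue, with i counted from 1. *)
Definition laplacian_mu (i : nat) : R := nth 0 laplacian_spectrum i.-1.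

End Laplacian.

(* Main.v *)
Require Import Defs.
From HB Require Import structures.
From mathcomp Require Import all_boot all_order all_algebra.
From mathcomp Require Import polyrcf complex spectral zify lra ring.

Set Implicit Arguments.
Unset Strict Implicit.
Unset Printing Implicit Defensive.

Import Order.TTheory GRing.Theory Num.Theory.

(** The hypotheses force more than property P(k, delta): the graph has k + 1
    edge-disjoint spanning trees. The last of them serves as the forest F, with
    n - 1 > (delta - 1) / delta * (n - 1) edges, and clause (c) is then vacuous.

    By the theorem of Nash-Williams and Tutte ([nash_williams_tutte]) it suffices
    that every partition of the vertices into t parts has cut sizes summing to
    at least 2 (k + 1) (t - 1). Call a nonempty vertex set small if its cut has
    at most 2k + 1 edges. Since 2k + 1 < delta, a small set has more than delta
    vertices ([card_gt_min_degree]), and the eigenvalue hypothesis excludes three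
    pairwise disjoint small sets: on the span of their indicator vectors the
    Rayleigh quotient of the Laplacian is at most 2 (2k + 1) / (delta + 1), so the
    Courant-Fischer principle ([spectrum_nth_le]) bounds the third smallest
    eigenvalue by this number ([laplacian_mu_three_sets]), which lies below
    16 (k + (delta - 1) / delta) / (3 (delta + 1)).

    Suppose some partition violates the Nash-Williams-Tutte condition. If the edge
    connectivity is at least k + 1, then counting at least k + 1 cut edges at
    every part and 2k + 2 at the parts that are not small shows that three parts
    are small ([three_small_parts]). If it is at most k, then three disjoint
    small sets are the two sets given by membership in G_1, whose cuts are
    minimum, and the complement of their union, whose cut has at most 2k edges
    ([cut_size_union]). Both cases are impossible.

    The Nash-Williams-Tutte theorem is obtained from a family of m disjoint
    forests of maximum total size. Let A be the set of edges that can be made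
    uncovered by exchanging an uncovered edge for an edge on its fundamental
    cycle in one of the forests, repeatedly. Every forest of the family spans
    the same connectivity relation inside A as A itself ([conn_freeable]), while
    all edges outside A are covered; comparing the number of these edges with
    the partition condition for the components of A leaves no room for a
    disconnected forest. *)

(** * Connectivity by an edge set, and acyclic edge sets *)

Lemma set2_inj (T : finType) (x y u v : T) :
  [set u; v] = [set x; y] -> (u = x /\ v = y) \/ (u = y /\ v = x).
Proof.
move=> E; have := set21 u v; have := set22 u v; rewrite E !inE.
have := set21 x y; have := set22 x y; rewrite -E !inE.
by do 4![case/orP=> /eqP ?]; subst; auto.
Qed.

Lemma connect_indr (T : finType) (r : rel T) (x : T) (P : T -> Prop) :
  P x -> (forall y z, connect r x y -> P y -> r y z -> P z) ->
  forall y, connect r x y -> P y.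
Proof.
move=> Px IH y /connectP[p]; elim/last_ind: p y => [y _ -> //|p z IHp y].
rewrite rcons_path last_rcons => /andP[pp rz] ->; apply: (IH (last x p)) => //.
  by apply/connectP; exists p.
exact: IHp.
Qed.

Section Forests.

Variable T : finType.
Implicit Types (S B : {set {set T}}) (f g : {set T}).

Lemma adjE S x y : adj_of S x y = (x != y) && ([set x; y] \in S).
Proof. by []. Qed.

Definition conn S : rel T := connect (adj_of S).

Lemma conn_symm S : symmetric (conn S).
Proof. by apply: sym_connect_sym => a b; rewrite !adjE eq_sym setUC. Qed.

Lemma conn_refl S x : conn S x x.
Proof. exact: connect0. Qed.

Lemma conn_trans S : transitive (conn S).
Proof. exact: connect_trans. Qed.

Lemma conn_edge S x y : [set x; y] \in S -> conn S x y.
Proof.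
move=> xyS; have [->|nxy] := eqVneq x y; first exact: conn_refl.
by apply: connect1; rewrite adjE nxy.
Qed.

Lemma conn_subrel S B :
  (forall x y, [set x; y] \in S -> conn B x y) -> subrel (conn S) (conn B).
Proof. by move=> sub; apply: connect_sub => x y; rewrite adjE => /andP[_ /sub]. Qed.

Lemma conn_subset S B : S \subset B -> subrel (conn S) (conn B).
Proof. by move/subsetP=> sub; apply: conn_subrel => x y /sub /conn_edge. Qed.

(** A connection using the new edge may be cut at its first and last passage
    through that edge. *)
Lemma conn_setU1 S x y a b :
  conn ([set x; y] |: S) a b =
  [|| conn S a b, conn S a x && conn S y b | conn S a y && conn S x b].
Proof.
apply/idP/idP; last first.
  have sub := @conn_subset S _ (subsetUr [set [set x; y]] S).
  have xy : conn ([set x; y] |: S) x y by apply/conn_edge/setU11.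
  case/or3P=> [/sub //|/andP[/sub ax /sub yb]|/andP[/sub ay /sub xb]].
    exact: conn_trans (conn_trans ax xy) yb.
  by rewrite conn_symm in xy; exact: conn_trans (conn_trans ay xy) xb.
move: b; apply: connect_indr => [|b c _ IH]; first by rewrite conn_refl.
rewrite adjE; case/andP=> nbc; rewrite !inE => /orP[/eqP /set2_inj|/conn_edge bc].
  case=> -[? ?]; subst; case/or3P: IH => [-> |/andP[-> _]|/andP[-> _]];
  by rewrite ?conn_refl ?orbT.
by case/or3P: IH => [ab|/andP[-> yb]|/andP[-> xb]]; rewrite ?(conn_trans ab bc)
  ?(conn_trans yb bc) ?(conn_trans xb bc) ?orbT.
Qed.

(** Acyclic in the sense of bridges: the ends of each edge are separated by
    deleting that edge. Being boolean and stable under exchanges, this form is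
    used for maximality arguments; [acyclic_forest] relates it to cycles. *)
Definition acyclic S :=
  [forall g in S, exists x, exists y, (g == [set x; y]) && ~~ conn (S :\ g) x y].

Lemma acyclicP S : reflect
  (forall g, g \in S -> exists x y, g = [set x; y] /\ ~~ conn (S :\ g) x y)
  (acyclic S).
Proof.
apply: (iffP forall_inP) => H g /H.
  by case/existsP=> x /existsP[y /andP[/eqP ? ?]]; exists x, y.
by move=> [x [y [-> ?]]]; apply/existsP; exists x; apply/existsP; exists y; rewrite eqxx.
Qed.

Lemma acyclic_edge S x y :
  acyclic S -> [set x; y] \in S -> ~~ conn (S :\ [set x; y]) x y.
Proof.
move/acyclicP=> H /H[u [v [E nc]]].
by case: (set2_inj E) nc => -[-> ->]; rewrite // conn_symm.
Qed.

Lemma acyclic_sub S B : B \subset S -> acyclic S -> acyclic B.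
Proof.
move=> BS /acyclicP aS; apply/acyclicP => g gB.
have [x [y [E nc]]] := aS g (subsetP BS g gB); exists x, y; split=> //.
by apply: contra nc; apply/conn_subset/setSD.
Qed.

Lemma acyclic0 : acyclic set0.
Proof. by apply/acyclicP => g; rewrite inE. Qed.

Lemma acyclic_setU1 S x y :
  acyclic S -> ~~ conn S x y -> acyclic ([set x; y] |: S).
Proof.
move=> aS nc; apply/acyclicP => g; rewrite !inE.
have [-> _|ng /= gS] := eqVneq g [set x; y].
  exists x, y; split=> //; apply: contra (nc); apply: conn_subset.
  by rewrite setU1K //; apply: contra nc => /conn_edge.
have [u [v [E nuv]]] := acyclicP _ aS g gS; exists u, v; split=> //.
have -> : ([set x; y] |: S) :\ g = [set x; y] |: (S :\ g).
  by apply/setP=> h; rewrite !inE; case: eqVneq => //= ->; rewrite (negPf ng).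
rewrite conn_setU1 !negb_or nuv /=.
have sub : subrel (conn (S :\ g)) (conn S) by apply/conn_subset/subD1set.
have uv : conn S u v by apply: conn_edge; rewrite -E.
apply/andP; split; apply: contra nc => /andP[/sub a /sub b].
  by rewrite conn_symm in a; rewrite conn_symm in b; exact: conn_trans (conn_trans a uv) b.
by rewrite conn_symm in uv; exact: conn_trans (conn_trans b uv) a.
Qed.

(** The edges of S whose deletion separates x from y are those of the unique path
    from x to y, so any set containing them connects x to y. The other edges are
    deleted one at a time, and the point is that no new edge h becomes critical
    when g is deleted: were it so, g and h would both join the component of x to
    that of y in the rest, and the ends of g would remain connected through h. *)
Lemma conn_critical S B x y :
  acyclic S -> conn S x y -> B \subset S ->
  (forall g, g \in S -> ~~ conn (S :\ g) x y -> g \in B) -> conn B x y.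
Proof.
have [m] := ubnP #|S :\: B|; elim: m S => // m IHm S; rewrite ltnS => leSm aS cS BS crit.
have [E|[g]] := set_0Vmem (S :\: B).
  by move: cS; apply: conn_subset; rewrite -setD_eq0 E.
move=> gSB; have := gSB; rewrite inE => /andP[gB gS].
have cg : conn (S :\ g) x y by apply: contraNT gB => /crit; apply.
apply: (IHm (S :\ g)) => //.
- apply: leq_trans leSm; apply: proper_card; apply/properP; split.
    by rewrite setSD ?subD1set.
  by exists g => //; rewrite !inE eqxx !andbF.
- exact: acyclic_sub (subD1set _ _) aS.
- by apply/subsetP=> h hB; rewrite !inE (subsetP BS) // andbT; apply: contraNneq gB => <-.
move=> h; rewrite inE => /andP[nhg]; rewrite inE in nhg => hS ncgh.
apply: crit => //; apply/negP=> ch.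
have [u [v [Eg nuv]]] := acyclicP _ aS g gS.
have [p [q [Eh npq]]] := acyclicP _ aS h hS.
set S0 := S :\ g :\ h in ncgh.
have Sg : S :\ g = [set p; q] |: S0 by rewrite -Eh setD1K // !inE nhg.
have Sh : S :\ h = [set u; v] |: S0.
  rewrite -Eg /S0; apply/setP=> z; rewrite !inE; case: (eqVneq z g) => [->|] //=.
  by rewrite eq_sym nhg gS.
move: cg ch nuv; rewrite Sg Sh !conn_setU1 (negPf ncgh) /=.
(* both edges join the class of x to the class of y *)
move=> A1 A2; apply/negP; rewrite negbK.
have tr a b c : conn S0 a b -> conn S0 a c -> conn S0 b c.
  by rewrite conn_symm => /conn_trans; apply.
have xu a b c : conn S0 a b -> conn S0 c b -> conn S0 a c.
  by move=> h1; rewrite conn_symm; exact: conn_trans.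
by case/orP: A1 => /andP[h1 h2]; case/orP: A2 => /andP[h3 h4];
  rewrite ?(tr _ _ _ h1 h3) ?(tr _ _ _ h3 h1) ?(xu _ _ _ h2 h4) ?(xu _ _ _ h4 h2) ?orbT.
Qed.

End Forests.

(** * Counting components *)

Section Count.

Variable T : finType.
Implicit Types (S B : {set {set T}}) (f g : {set T}).

Definition classes S : {set {set T}} := [set [set b | conn S a b] | a in T].

(** Components are counted through any labelling of the vertices that separates
    exactly the components, which makes the effect of merging two labels easy to
    compute. *)
Lemma card_classes (T' : finType) S (r : T -> T') :
  (forall a b, conn S a b = (r a == r b)) -> #|classes S| = #|r @: T|.
Proof.
move=> rE; pose h c := [set b | c == r b].
have -> : classes S = h @: (r @: T).
  rewrite -imset_comp; apply: eq_imset => a; apply/setP=> b.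
  by rewrite !inE rE.
rewrite card_in_imset // => _ _ /imsetP[a _ ->] /imsetP[b _ ->] /setP/(_ b).
by rewrite !inE eqxx => /eqP.
Qed.

Lemma conn_root S a b :
  conn S a b = (fingraph.root (adj_of S) a == fingraph.root (adj_of S) b).
Proof. by rewrite root_connect //; exact: conn_symm. Qed.

Lemma eq_classes S B : conn S =2 conn B -> classes S = classes B.
Proof. by move=> E; apply: eq_imset => a; apply/setP=> b; rewrite !inE E. Qed.

(** Relabelling the component of y by the label of x removes one label. *)
Lemma card_classes_setU1 S x y :
  ~~ conn S x y -> #|classes ([set x; y] |: S)|.+1 = #|classes S|.
Proof.
move=> nc; set r := fingraph.root (adj_of S).
have rE a b : conn S a b = (r a == r b) by exact: conn_root.
pose r' a := if r a == r y then r x else r a.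
have r'E a b : conn ([set x; y] |: S) a b = (r' a == r' b).
  rewrite conn_setU1 !rE /r'; rewrite rE in nc.
  rewrite (eq_sym (r y) (r b)) (eq_sym (r x) (r b)).
  case: (eqVneq (r a) (r y)) => [->|ay]; case: (eqVneq (r b) (r y)) => [->|b_y].
  - by rewrite eqxx.
  - by rewrite andbF /= eq_sym.
  - by rewrite (negPf ay) andbT orbF.
  - by rewrite andbF !orbF.
rewrite (card_classes rE) (card_classes r'E).
have -> : r' @: T = (r @: T) :\ r y.
  apply/setP=> c; rewrite !inE; apply/imsetP/andP.
    case=> a _ ->; rewrite /r'; case: ifP => [_|/negbT ay].
      by rewrite -rE; split=> //; apply: imset_f.
    by split=> //; apply: imset_f.
  by case=> cy /imsetP[a _ E]; exists a => //; rewrite /r' -E (negPf cy).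
by rewrite [RHS](cardsD1 (r y)) imset_f.
Qed.

Lemma card_acyclic S : acyclic S -> #|S| + #|classes S| = #|T|.
Proof.
have [m] := ubnP #|S|; elim: m S => // m IHm S leSm aS.
have [->|[g gS]] := set_0Vmem S.
  rewrite cards0 (@card_classes _ set0 id) ?card_imset // => a b.
  apply/idP/eqP => [|->]; last exact: conn_refl.
  move: b; apply: connect_indr => // y z _ ->; rewrite adjE inE andbF //.
have [x [y [E nc]]] := acyclicP _ aS g gS.
have gE : [set x; y] |: (S :\ g) = S by rewrite -E setD1K.
have := card_classes_setU1 nc; rewrite gE => cE.
have cS : #|S| = #|S :\ g|.+1 by rewrite (cardsD1 g) gS.
rewrite cS addSnnS cE IHm //; last exact: acyclic_sub (subD1set _ _) aS.
by rewrite cS ltnS in leSm.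
Qed.

Lemma partition_classes S : partition (classes S) [set: T].
Proof.
have -> : classes S = equivalence_partition (conn S) [set: T].
  apply/setP=> X; apply/imsetP/imsetP=> -[a _ ->]; exists a; rewrite ?inE //;
  by apply/setP=> b; rewrite !inE.
apply: equivalence_partitionP => x y z _ _ _; split; first exact: conn_refl.
by move=> xy; apply/idP/idP; apply: conn_trans; rewrite // conn_symm.
Qed.

Lemma connected_classes S : #|classes S| <= 1 -> connected_by S.
Proof.
move=> c1; apply/forallP=> x; apply/forallP=> y.
have := card_le1_eqP c1 [set b | conn S x b] [set b | conn S y b]
  (imset_f _ _) (imset_f _ _).
move/(_ isT isT)/setP/(_ y); by rewrite !inE conn_refl.
Qed.

Lemma classes_gt0 S : 0 < #|T| -> 0 < #|classes S|.
Proof.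
by move/card_gt0P=> [x _]; apply/card_gt0P; exists [set b | conn S x b]; apply: imset_f.
Qed.

(** A cycle x y z ... would connect y back to x by a path that meets x only at its
    end, and at that end not through y, hence without the edge xy. *)
Lemma acyclic_forest S : acyclic S -> is_forest S.
Proof.
move=> aS [|x [|y [|z c]]] // _ /andP[]; rewrite /= !inE !negb_or.
rewrite !rcons_path => /and4P[xy yz zc cx].
case/andP=> /and3P[nxy nxz nxc] /andP[/andP[nyz nyc] _].
have xyS : [set x; y] \in S by move: xy; rewrite adjE => /andP[].
have /negP[] := acyclic_edge aS xyS.
have nx u v : u \in predC1 x -> v \in predC1 x -> adj_of S u v ->
    adj_of (S :\ [set x; y]) u v.
  rewrite !inE !adjE !inE => ux vx /andP[-> ->]; rewrite andbT /=.
  apply/eqP=> E; case: (set2_inj E) => -[? ?]; subst; last by rewrite eqxx in vx.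
  by rewrite eqxx in ux.
rewrite conn_symm; apply: (@conn_trans _ _ (last z c)).
  apply/connectP; exists (z :: c) => //.
  apply: (sub_in_path (P := predC1 x) (e := adj_of S)).
  - by move=> u v; apply: nx.
  - rewrite /= (eq_sym y) nxy (eq_sym z) nxz /=; apply/allP=> w wc.
    by apply: contraNneq nxc => <-.
  - by rewrite /= yz.
apply: connect1; move: cx; rewrite !adjE !inE => /andP[-> ->]; rewrite andbT /=.
apply/eqP=> E; have : last z c \in z :: c by exact: mem_last.
have : y \in [set last z c; x] by rewrite E set22.
rewrite !inE eq_sym orbC => /orP[/eqP yx|/eqP ->]; first by rewrite yx eqxx in nxy.
by rewrite (negPf nyz) (negPf nyc).
Qed.

End Count.

(** * The Nash-Williams-Tutte theorem *)

Section Packing.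

Variables (T : finType) (E : {set {set T}}) (m : nat).
Hypothesis edgeP : forall f, f \in E -> exists x y, f = [set x; y].

Implicit Types (f g h : {set T}) (F : {ffun 'I_m -> {set {set T}}}) (A B : {set {set T}}).

Definition forest_family F : bool :=
  [forall i, (F i \subset E) && acyclic (F i)] &&
  [forall i, forall j, (i != j) ==> [disjoint F i & F j]].

Lemma forest_familyP F : reflect
  [/\ forall i, F i \subset E, forall i, acyclic (F i)
    & forall i j, i != j -> [disjoint F i & F j]] (forest_family F).
Proof.
apply: (iffP andP) => [[/forallP H /'forall_'forall_implyP D]|[H1 H2 D]].
  by split=> // i; case/andP: (H i).
split; first by apply/forallP=> i; rewrite H1 H2.
by apply/'forall_'forall_implyP.
Qed.

Definition uncovered F f : bool := (f \in E) && [forall i, f \notin F i].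

Lemma uncoveredP F f :
  reflect (f \in E /\ forall i, f \notin F i) (uncovered F f).
Proof. by apply: (iffP andP) => -[? /forallP]. Qed.

Definition exchange F i f g : {ffun 'I_m -> {set {set T}}} :=
  [ffun j => if j == i then f |: (F i :\ g) else F j].

Lemma exchange_at F i f g : exchange F i f g i = f |: (F i :\ g).
Proof. by rewrite ffunE eqxx. Qed.

Lemma exchange_off F i f g j : j != i -> exchange F i f g j = F j.
Proof. by rewrite ffunE => /negPf ->. Qed.

(** With B = F i this enlarges the family by an edge, and with B = F i minus an
    edge it is an exchange. *)
Lemma exchange_family F i x y B :
  forest_family F -> uncovered F [set x; y] -> B \subset F i -> ~~ conn B x y ->
  forest_family [ffun j => if j == i then [set x; y] |: B else F j].
Proof.
case/forest_familyP=> FE aF dF /uncoveredP[fE fF] BF nc.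
apply/forest_familyP; split=> [j|j|j l]; rewrite !ffunE.
- by case: eqP => // _; rewrite subUset sub1set fE (subset_trans BF).
- by case: eqP => // _; apply: acyclic_setU1 => //; apply: acyclic_sub (aF i).
have dB l' : l' != i -> [disjoint [set x; y] |: B & F l'].
  move=> li; rewrite -setI_eq0 setIUl setU_eq0 !setI_eq0 disjoints1 fF /=.
  by rewrite (disjointWl BF) // dF // eq_sym.
case: (eqVneq j i) => [ji|ji]; case: (eqVneq l i) => [li|li] njl.
- by rewrite ji li eqxx in njl.
- exact: dB.
- by rewrite disjoint_sym; apply: dB.
- exact: dF.
Qed.

Definition family_size F := \sum_i #|F i|.

Definition exchange_step : rel {ffun 'I_m -> {set {set T}}} := fun F F' =>
  [exists i, exists x, exists y, exists g,
    [&& uncovered F [set x; y], g \in F i, ~~ conn (F i :\ g) x y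
      & F' == exchange F i [set x; y] g]].

Lemma exchange_stepP F F' : reflect
  (exists i x y g, [/\ uncovered F [set x; y], g \in F i,
    ~~ conn (F i :\ g) x y & F' = exchange F i [set x; y] g])
  (exchange_step F F').
Proof.
apply: (iffP existsP) => [[i /existsP[x /existsP[y /existsP[g]]]]|].
  by case/and4P=> ? ? ? /eqP ->; exists i, x, y, g.
case=> i [x [y [g [? ? ? ->]]]]; exists i; apply/existsP; exists x.
by apply/existsP; exists y; apply/existsP; exists g; apply/and4P.
Qed.

Lemma forest_family_size_max : exists2 F, forest_family F &
  forall F', forest_family F' -> family_size F' <= family_size F.
Proof.
have ff0 : forest_family [ffun=> set0].
  apply/forest_familyP; split=> *; rewrite !ffunE ?sub0set ?acyclic0 //.
  by rewrite -setI_eq0 set0I.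
have [F] := arg_maxnP family_size ff0; by exists F.
Qed.

Section Maximal.

Variable F0 : {ffun 'I_m -> {set {set T}}}.
Hypothesis F0_family : forest_family F0.
Hypothesis F0_max : forall F', forest_family F' -> family_size F' <= family_size F0.

(** The edges left uncovered by some family reachable from F0 by exchanges. *)
Definition freeable : {set {set T}} :=
  [set f in E | [exists F, connect exchange_step F0 F && uncovered F f]].

Lemma uncovered_freeable F f :
  connect exchange_step F0 F -> uncovered F f -> f \in freeable.
Proof.
move=> cF uf; rewrite inE; case/uncoveredP: (uf) => -> _ /=.
by apply/existsP; exists F; rewrite cF.
Qed.

Lemma exchange_uncovered F i f g : forest_family F -> uncovered F f ->
  g \in F i -> uncovered (exchange F i f g) g.
Proof.
case/forest_familyP=> FE aF dF /uncoveredP[fE fF] gF.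
have ngf : g != f by apply: contraNneq (fF i) => <-.
apply/uncoveredP; split=> [|j]; first exact: subsetP (FE i) g gF.
have [->|ji] := eqVneq j i; first by rewrite exchange_at !inE eqxx orbF.
rewrite exchange_off //.
by apply/negP=> gFj; move: (dF _ _ ji); rewrite disjoint_subset =>
  /subsetP /(_ g gFj); rewrite inE gF.
Qed.

Lemma exchange_size F i f g : uncovered F f -> g \in F i ->
  family_size (exchange F i f g) = family_size F.
Proof.
case/uncoveredP=> fE fF gF; apply: eq_bigr => j _.
have [->|ji] := eqVneq j i; last by rewrite exchange_off.
by rewrite exchange_at cardsU1 !inE (negPf (fF i)) andbF (cardsD1 g (F i)) gF.
Qed.

(** Otherwise the uncovered edge could be added, against maximality. *)
Lemma uncovered_conn F i x y : forest_family F ->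
  family_size F = family_size F0 -> uncovered F [set x; y] -> conn (F i) x y.
Proof.
move=> fF sF uf; apply/negPn/negP=> nc.
have := F0_max (exchange_family fF uf (subxx (F i)) nc).
rewrite -sF leqNgt => /negP[].
rewrite /family_size (bigD1 i) // [X in _ < X](bigD1 i) //= ffunE eqxx.
case/uncoveredP: uf => _ nf; rewrite cardsU1 nf /= addSn ltnS leq_add2l.
by apply/eq_leq/eq_bigr => j ji; rewrite ffunE (negPf ji).
Qed.

(** Exchanging the uncovered edge xy for any edge on the path from x to y in F i
    uncovers that edge, so the whole path consists of freeable edges. *)
Lemma uncovered_conn_freeable F i x y :
  connect exchange_step F0 F -> forest_family F ->
  family_size F = family_size F0 -> uncovered F [set x; y] ->
  conn (F i :&: freeable) x y.
Proof.
move=> cF fF sF uf; have cxy := uncovered_conn i fF sF uf.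
have aF : acyclic (F i) by case/forest_familyP: fF.
apply: (conn_critical aF cxy (subsetIl _ _)) => g gF nc; rewrite inE gF /=.
apply: (@uncovered_freeable (exchange F i [set x; y] g)).
  apply: connect_trans cF (connect1 _).
  by apply/exchange_stepP; exists i, x, y, g.
exact: exchange_uncovered.
Qed.

(** Exchanges preserve the connectivity relation of the freeable part of each
    forest: both the edge xy brought in and the edge g taken out are freeable,
    and they lie on a common cycle of freeable edges. *)
Lemma reachable_invariant F : connect exchange_step F0 F ->
  [/\ forest_family F, family_size F = family_size F0
    & forall i, conn (F i :&: freeable) =2 conn (F0 i :&: freeable)].
Proof.
move: F; apply: connect_indr => // F F' cF [fF sF eF] st.
have cF' := connect_trans cF (connect1 st).
have [i [x [y [g [uf gF nc E']]]]] := exchange_stepP _ _ st; subst F'.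
split.
- by apply: exchange_family => //; exact: subD1set.
- by rewrite exchange_size.
move=> j a b; rewrite -eF; have [->|ji] := eqVneq j i; last by rewrite exchange_off.
rewrite exchange_at.
have gA := uncovered_freeable cF' (exchange_uncovered fF uf gF).
have fA := uncovered_freeable cF uf.
have cxy := uncovered_conn_freeable i cF fF sF uf.
set S := F i :&: freeable in cxy *.
have -> : ([set x; y] |: F i :\ g) :&: freeable = [set x; y] |: (S :\ g).
  by rewrite setIUl setIDAC (setIidPl _) // sub1set.
have gS : g \in S by rewrite inE gF.
have ncS : ~~ conn (S :\ g) x y.
  by apply: contra nc; apply/conn_subset/setSD/subsetIl.
have [u [v gE]] : exists u v, g = [set u; v].
  by apply: edgeP; case/forest_familyP: fF => /(_ i)/subsetP/(_ g gF).
have SE : [set u; v] |: (S :\ g) = S by rewrite -gE setD1K.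
have cuv : conn ([set x; y] |: S :\ g) u v.
  rewrite conn_setU1; move: cxy; rewrite -{1}SE conn_setU1 (negPf ncS) /=.
  by case/orP=> /andP[h1 h2]; rewrite ?(conn_symm _ u x) ?(conn_symm _ y v) ?h1 ?h2 ?orbT.
apply/idP/idP; apply: conn_subrel => p q.
  rewrite in_setU1 => /orP[/eqP /set2_inj [] [-> ->] //|]; first by rewrite conn_symm.
  by case/setD1P=> _ /conn_edge.
rewrite -{1}SE in_setU1 => /orP[/eqP /set2_inj [] [-> ->] //|]; first by rewrite conn_symm.
by move=> h; apply: conn_edge; rewrite in_setU1 h orbT.
Qed.

(** A freeable edge has its ends connected by the freeable part of F i for the
    family F that leaves it uncovered, hence also for the initial family. *)
Lemma conn_freeable i : conn freeable =2 conn (F0 i :&: freeable).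
Proof.
move=> a b; apply/idP/idP; last exact/conn_subset/subsetIr.
apply: conn_subrel => x y; rewrite inE => /andP[_ /existsP[F /andP[cF uf]]].
have [fF sF eF] := reachable_invariant cF.
by rewrite -eF; apply: uncovered_conn_freeable.
Qed.

Lemma card_forest_off_freeable i :
  #|F0 i :\: freeable| + #|classes (F0 i)| = #|classes freeable|.
Proof.
have aF : acyclic (F0 i) by case/forest_familyP: F0_family.
have := card_acyclic aF; have := card_acyclic (acyclic_sub (subsetIl _ freeable) aF).
rewrite (eq_classes (fun a b => esym (conn_freeable i a b))).
by rewrite -(cardsID freeable (F0 i)); lia.
Qed.

(** An edge covered by no forest of the initial family is freeable. *)
Lemma card_off_freeable : #|E :\: freeable| <= \sum_i #|F0 i :\: freeable|.
Proof.
have sub : E :\: freeable \subset \bigcup_i (F0 i :\: freeable).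
  apply/subsetP=> f /setDP[fE nf]; apply/bigcupP.
  have : ~~ uncovered F0 f by apply: contra nf; apply: uncovered_freeable.
  rewrite /uncovered fE /= => /forallPn[j]; rewrite negbK => fj.
  by exists j => //; rewrite inE nf.
apply: leq_trans (subset_leq_card sub) _.
apply: (big_ind2 (fun (A : {set {set T}}) k => #|A| <= k)) => [|A a B b leA leB|//].
  by rewrite cards0.
exact: leq_trans (leq_card_setU _ _) (leq_add leA leB).
Qed.

End Maximal.

Definition boundary (X : {set T}) : {set {set T}} :=
  [set f in E | (f :&: X != set0) && ~~ (f \subset X)].

(** An edge lies in the boundary of at most two parts, those of its ends. *)
Lemma sum_boundary (Q B : {set {set T}}) : trivIset Q ->
  (forall X f, X \in Q -> f \in B -> f \notin boundary X) ->
  \sum_(X in Q) #|boundary X| <= 2 * #|E :\: B|.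
Proof.
move=> tQ offB.
have -> : \sum_(X in Q) #|boundary X| =
          \sum_(f in E :\: B) #|[set X in Q | f \in boundary X]|.
  under eq_bigr => X XQ.
    rewrite -sum1_card big_mkcond.
    rewrite (eq_bigr (fun f => (f \in boundary X) : nat)); last by move=> f _; case: ifP.
  over.
  rewrite exchange_big /= (bigID (mem (E :\: B))) /= [X in _ + X]big1 ?addn0.
    apply: eq_bigr => f _; rewrite -sum1_card big_mkcond [RHS]big_mkcond /=.
    by apply: eq_bigr => X _; rewrite !inE; case: (X \in Q) => //=; case: ifP.
  move=> f nf; rewrite big1 // => X XQ; case fX: (f \in boundary X) => //.
  have fE : f \in E by move: fX; rewrite inE => /andP[].
  by move: nf; rewrite inE fE andbT negbK => fB; rewrite -fX (negPf (offB X f XQ fB)).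
rewrite mulnC -sum_nat_const; apply: leq_sum => f; rewrite inE => /andP[_ fE].
have [x [y fxy]] := edgeP fE.
apply: leq_trans (_ : #|[set pblock Q x; pblock Q y]| <= 2); last by rewrite cards2; case: eqP.
apply/subset_leq_card/subsetP=> X; rewrite inE => /andP[XQ].
rewrite inE => /and3P[_ /set0Pn[z]]; rewrite !inE fxy !inE => /andP[/orP[] /eqP -> zX _].
  by rewrite (def_pblock tQ XQ zX) eqxx.
by rewrite (def_pblock tQ XQ zX) eqxx orbT.
Qed.

(** Let t be the number of components of the freeable set A. There are at least
    m (t - 1) edges between these components, all covered, while F i has at most
    t - 1 edges outside A, with equality only if F i is connected. *)
Theorem nash_williams_tutte :
  (forall Q, partition Q [set: T] ->
     2 * (m * #|Q|.-1) <= \sum_(X in Q) #|boundary X|) ->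
  0 < #|T| ->
  exists F : 'I_m -> {set {set T}},
    [/\ forall i, F i \subset E, forall i, is_spanning_tree (F i),
        forall i, #|F i|.+1 = #|T|
      & forall i j, i != j -> [disjoint F i & F j]].
Proof.
move=> cutQ T_gt0; have [F fF Fmax] := forest_family_size_max.
have [FE aF dF] := forest_familyP _ fF; exists F.
suff one i : #|classes (F i)| <= 1.
  split=> // i; first by split; [apply: connected_classes | apply: acyclic_forest].
  by rewrite -(card_acyclic (aF i)); have := one i; have := classes_gt0 (F i) T_gt0; lia.
set A := freeable F; set t := #|classes A|.
have partA := partition_classes A.
have tA : t.-1 + 1 = t by rewrite addn1 prednK // classes_gt0.
have := cutQ _ partA; rewrite -/t => lecut.
have lesum : m * t.-1 <= \sum_j #|F j :\: A|.
  apply: leq_trans (card_off_freeable F).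
  suff : 2 * (m * t.-1) <= 2 * #|E :\: A| by rewrite leq_pmul2l.
  apply: leq_trans lecut (sum_boundary _ _); first by case/and3P: partA.
  move=> X f /imsetP[a _ ->] fA; apply/negP; rewrite !inE => /and3P[/edgeP [x [y fxy]]].
  rewrite fxy in fA *; case/set0Pn=> z; rewrite !inE => /andP[zxy az] /negP[].
  have xy := conn_edge fA; have yx := xy; rewrite conn_symm in yx.
  by case/orP: zxy => /eqP zE; subst z; apply/subsetP=> w; rewrite !inE
    => /orP[] /eqP -> //; apply: conn_trans az _.
have le1 j : #|F j :\: A| <= t.-1.
  have := card_forest_off_freeable fF Fmax j; have := classes_gt0 (F j) T_gt0.
  by rewrite -/A -/t; lia.
have := card_forest_off_freeable fF Fmax i; rewrite -/A -/t.
suff : t.-1 <= #|F i :\: A| by lia.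
move: lesum; rewrite (bigD1 i) //= -[m in m * _]card_ord -sum_nat_const (bigD1 i) //=.
have : \sum_(j < m | j != i) #|F j :\: A| <= \sum_(j < m | j != i) t.-1 by exact: leq_sum.
move=> h1 h2; rewrite -(leq_add2r (\sum_(j < m | j != i) t.-1)).
by apply: leq_trans h2 _; rewrite leq_add2l.
Qed.

End Packing.

(** * Courant-Fischer bound for real symmetric matrices *)

Section Spectral.
Local Open Scope ring_scope.
Local Open Scope sesquilinear_scope.

Lemma char_poly_conj (F : fieldType) n (P B : 'M[F]_n) : P \in unitmx ->
  char_poly (invmx P *m B *m P) = char_poly B.
Proof.
move=> uP; rewrite /char_poly /char_poly_mx !map_mxM /=.
set P' := map_mx polyC P; set Q' := map_mx polyC (invmx P).
have QP : Q' *m P' = 1%:M by rewrite -map_mxM mulVmx // map_mx1.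
have -> : 'X%:M - Q' *m map_mx polyC B *m P' =
          Q' *m ('X%:M - map_mx polyC B) *m P'.
  by rewrite mulmxBr mulmxBl scalar_mxC -['X%:M *m _ *m _]mulmxA QP mulmx1.
rewrite !det_mulmx mulrC mulrA -det_mulmx.
by rewrite (mulmx1C QP) det1 mul1r.
Qed.

(** [laplacian_spectrum] for an arbitrary square matrix. *)
Definition spectrum (R : rcfType) n (A : 'M[R]_n) : seq R :=
  let p := char_poly A in
  sort >=%R (flatten [seq nseq (mup x p) x | x <- rootsR p]).

Lemma spectrum_split (R : rcfType) n (A : 'M[R]_n) (s : seq R) :
  char_poly A = \prod_(x <- s) ('X - x%:P) -> perm_eq (spectrum A) s.
Proof.
move=> pE; rewrite /spectrum perm_sort; apply/allP=> x _; apply/eqP.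
set p := char_poly A in pE *.
have p0 : p != 0 by rewrite monic_neq0 // char_poly_monic.
rewrite count_flatten -map_comp sumnE big_map.
have E y : (count_mem x \o (fun x0 => nseq (mup x0 p) x0)) y = ((y == x) * mup y p)%N.
  by rewrite /= count_nseq.
under eq_bigr => y _ do rewrite E.
rewrite -[RHS]mu_prod_XsubC -pE.
have [xr|xr] := boolP (x \in rootsR p).
  rewrite (bigD1_seq x) ?uniq_roots //= eqxx mul1n big1 ?addn0 // => y.
  by move=> /negPf ->.
rewrite big_seq big1 => [|y yr].
  rewrite mupNroot //; apply: contra xr => rx.
  by rewrite -(roots_on_rootsR p0) inE rx.
by case: eqP => // yx; rewrite yx (negPf xr) in yr.
Qed.

Definition quad (F : comNzRingType) n (A : 'M[F]_n) (v w : 'rV[F]_n) : F :=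
  (v *m A *m w^T) 0 0.

(** Over the complex numbers the quadratic form of a real symmetric matrix splits
    into its values at the real and imaginary parts, the mixed terms cancelling
    by symmetry. This transfers real bounds to complex vectors. *)
Lemma quad_complex (R : rcfType) n (A : 'M[R]_n) (v : 'rV[R[i]]_n) :
  A^T = A ->
  (v *m map_mx (real_complex R) A *m v^t*) 0 0 =
  (quad A (map_mx (@complex.Re R) v) (map_mx (@complex.Re R) v) +
   quad A (map_mx (@complex.Im R) v) (map_mx (@complex.Im R) v))%:C%C.
Proof.
move=> symA; set a := map_mx _ v; set b := map_mx _ v.
have vE : v = map_mx (real_complex R) a + 'i%C *: map_mx (real_complex R) b.
  by apply/matrixP=> i j; rewrite !mxE -complexE.
have vcE : v^t* = map_mx (real_complex R) a^T - 'i%C *: map_mx (real_complex R) b^T.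
  apply/matrixP=> i j; rewrite !mxE; case: (v j i) => x y /=.
  apply/eqP; rewrite eq_complex /=; apply/andP; split; apply/eqP; ring.
rewrite vcE {1}vE mulmxDl mulmxBr !mulmxDl -!scalemxAl -!scalemxAr -!map_mxM.
have sab : b *m A *m a^T = (a *m A *m b^T)^T.
  by rewrite !trmx_mul trmxK symA mulmxA.
rewrite sab scalerA -expr2 sqr_i /quad.
move: (a *m A *m a^T) (a *m A *m b^T) (b *m A *m b^T) => X Y Z.
rewrite !mxE; apply/eqP; rewrite eq_complex /=.
by apply/andP; split; apply/eqP; ring.
Qed.

Lemma quad_subr_scalar (R : rcfType) n (A : 'M[R]_n) (v : 'rV[R]_n) (rho : R) :
  quad (A - rho%:M) v v = quad A v v - rho * quad 1%:M v v.
Proof.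
rewrite /quad mulmxBr mulmxBl mul_mx_scalar -scalemxAl mulmx1.
by rewrite [in LHS]mxE [X in _ + X]mxE [X in _ - X]mxE.
Qed.

(** The unitary diagonalization over R[i] has real eigenvalues, so it also splits
    the characteristic polynomial over R. *)
Lemma symmetric_spectral (R : rcfType) n (A : 'M[R]_n) : A^T = A ->
  exists (P : 'M[R[i]]_n) (d : 'rV[R]_n),
    [/\ P \is unitarymx,
        map_mx (real_complex R) A =
          P^t* *m diag_mx (map_mx (real_complex R) d) *m P
      & perm_eq (spectrum A) [seq d 0 j | j <- enum 'I_n]].
Proof.
move=> symA; set A' := map_mx _ A.
have realA : A' \is a mxOver Num.real.
  by apply/mxOverP=> i j; rewrite mxE complex_real.
have hA : A' \is hermsymmx.
  apply: realsym_hermsym => //; apply/is_hermitianmxP.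
  by rewrite expr0 scale1r map_mx_id // /A' map_trmx symA.
have AE := orthomx_spectralP (hermitian_normalmx hA).
have unP := spectral_unitarymx A'.
have /mxOverP realD := hermitian_spectral_diag_real hA.
pose d : 'rV[R]_n := map_mx (@complex.Re R) (spectral_diag A').
have dE : spectral_diag A' = map_mx (real_complex R) d.
  by apply/matrixP=> i j; rewrite !mxE RRe_real.
exists (spectralmx A'), d; split=> //.
  by rewrite -dE -invmx_unitary.
apply: spectrum_split; apply: (map_poly_inj (real_complex R)).
rewrite map_char_poly -/A' AE char_poly_conj ?spectral_unit // dE.
rewrite char_poly_trig ?diag_mx_is_trig // rmorph_prod big_map big_enum /=.
by apply: eq_bigr => j _; rewrite map_polyXsubC !mxE eqxx mulr1n.
Qed.

(** If the eigenvalue of index n - p exceeded rho, fewer than p eigenvalues would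
    be at most rho. Some nonzero v in the complex span of the p rows of U would
    then be orthogonal to all their eigenvectors, making the quadratic form at v
    strictly larger than rho times the squared norm of v. *)
Theorem spectrum_nth_le (R : rcfType) n p (A : 'M[R]_n) (U : 'M[R]_(p, n)) rho :
  A^T = A -> row_free U -> (0 < p)%N ->
  (forall c : 'rV[R]_p, quad A (c *m U) (c *m U) <= rho * quad 1%:M (c *m U) (c *m U)) ->
  (spectrum A)`_(n - p) <= rho.
Proof.
move=> symA fU p_gt0 leU; rewrite leNgt; apply/negP=> gt_rho.
have [P [d [unP AE pe]]] := symmetric_spectral symA.
have pn : (p <= n)%N by rewrite -(eqP fU) rank_leq_col.
pose J := [set j | d 0 j <= rho].
have ltJ : (#|J| < p)%N.
  have sz : size (spectrum A) = n by rewrite (perm_size pe) size_map size_enum_ord.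
  have -> : #|J| = count (fun x => x <= rho) (spectrum A).
    rewrite (permP pe) count_map -size_filter cardE; congr (size _).
    by rewrite enumT; apply: eq_filter => j; rewrite !inE.
  rewrite -(cat_take_drop (n - p).+1 (spectrum A)) count_cat.
  have -> : count (fun x => x <= rho) (take (n - p).+1 (spectrum A)) = 0%N.
    apply/eqP; rewrite -leqn0 leqNgt -has_count -all_predC; apply/(all_nthP 0) => i.
    rewrite size_takel ?sz; last by lia.
    move=> ip; rewrite nth_take //= -ltNge; apply: lt_le_trans gt_rho _.
    have so : sorted >=%R (spectrum A) by apply: sort_sorted => x y; exact: le_total.
    have tr : transitive (>=%R : rel R) by move=> x y z h1 h2; apply: le_trans h2 h1.
    have rf : reflexive (>=%R : rel R) by move=> x; apply: lexx.
    by apply: (sorted_leq_nth tr rf 0 so); rewrite ?inE ?sz; lia.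
  rewrite add0n; apply: leq_ltn_trans (count_size _ _) _.
  by rewrite size_drop sz; lia.
(* row i of M lists the coordinates of row i of U in the eigenbasis, so a vector c
   killing the columns of M in J makes v orthogonal to the eigenvectors of J *)
pose U' := map_mx (real_complex R) U; pose M := U' *m P^t*.
pose N := colsub (enum_val : 'I_#|J| -> 'I_n) M.
have ker0 : kermx N != 0.
  by rewrite kermx_eq0 /row_free neq_ltn (leq_ltn_trans (rank_leq_col _)).
have [c /sub_kermxP cN c0] := rowV0Pn ker0.
pose v := c *m U'; pose y := v *m P^t*.
have vE : v = y *m P by rewrite /y mulmxKtV.
have y0 : y != 0.
  apply: contra_neq c0 => y0; apply: (row_free_inj (A := U')); first by rewrite row_free_map.
  by rewrite mul0mx -/v vE y0 mul0mx.
have yJ j : j \in J -> y 0 j = 0.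
  move=> jJ; have /matrixP/(_ 0 (enum_rank_in jJ j)) := cN.
  by rewrite /N mulmx_colsub [LHS]mxE [RHS]mxE enum_rankK_in // /y /v -mulmxA.
have conjE (w : 'rV[R[i]]_n) : (w *m P^t* )^t* = P *m w^t*.
  by rewrite trmx_mul map_mxM /= trmxCK.
have normE (D : 'rV[R]_n) :
   (v *m (P^t* *m diag_mx (map_mx (real_complex R) D) *m P) *m v^t*) 0 0
     = \sum_j (D 0 j)%:C%C * `|y 0 j| ^+ 2.
  have -> : v *m (P^t* *m diag_mx (map_mx (real_complex R) D) *m P) *m v^t* =
            y *m diag_mx (map_mx (real_complex R) D) *m y^t*.
    by rewrite /y conjE !mulmxA.
  rewrite mul_mx_diag mxE; apply: eq_bigr => j _; rewrite !mxE normCK.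
  by rewrite mulrAC mulrC mulrA.
pose rR := map_mx (@complex.Re R) c; pose iR := map_mx (@complex.Im R) c.
have vRI : v = map_mx (real_complex R) (rR *m U) + 'i%C *: map_mx (real_complex R) (iR *m U).
  rewrite !map_mxM scalemxAl -mulmxDl; congr (_ *m _).
  by apply/matrixP=> i j; rewrite !mxE -complexE.
have reE : map_mx (@complex.Re R) v = rR *m U.
  apply/matrixP=> i j; rewrite [LHS]mxE vRI.
  by move: (rR *m U) (iR *m U) => X Y; rewrite !mxE /=; ring.
have imE : map_mx (@complex.Im R) v = iR *m U.
  apply/matrixP=> i j; rewrite [LHS]mxE vRI.
  by move: (rR *m U) (iR *m U) => X Y; rewrite !mxE /=; ring.
have symB : (A - rho%:M)^T = A - rho%:M by rewrite linearB /= symA tr_scalar_mx.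
have := quad_complex v symB.
rewrite map_mxB map_scalar_mx AE.
have -> : P^t* *m diag_mx (map_mx (real_complex R) d) *m P - (real_complex R rho)%:M =
   P^t* *m diag_mx (map_mx (real_complex R) (d - const_mx rho)) *m P.
  rewrite map_mxB map_const_mx linearB /= mulmxBr mulmxBl diag_const_mx; congr (_ - _).
  rewrite mul_mx_scalar -scalemxAl -[X in _ *: (_ *m X)]trmxCK.
  have /unitarymxP -> : P^t* \is unitarymx by rewrite trmxC_unitary.
  by rewrite scalemx1.
rewrite normE reE imE => eqs.
have : (\sum_j ((d - const_mx rho) 0 j)%:C%C * `|y 0 j| ^+ 2 : R[i]) <= 0.
  by rewrite eqs lecR !quad_subr_scalar; have := leU rR; have := leU iR; lra.
move=> le0; suff /lt_le_trans/(_ le0) :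
    0 < \sum_j ((d - const_mx rho) 0 j)%:C%C * `|y 0 j| ^+ 2 :> R[i].
  by rewrite ltxx.
have [j yj] : exists j, y 0 j != 0 by apply/rV0Pn.
have term l : 0 <= ((d - const_mx rho) 0 l)%:C%C * `|y 0 l| ^+ 2 :> R[i].
  have [/yJ ->|] := boolP (l \in J); first by rewrite normr0 expr0n mulr0.
  rewrite inE -ltNge => lt; rewrite mulr_ge0 ?exprn_ge0 // ler0c !mxE subr_ge0.
  exact: ltW.
rewrite (bigD1 j) //= ltr_wpDr ?sumr_ge0 //.
rewrite mulr_gt0 ?exprn_gt0 ?normr_gt0 // ltcR !mxE subr_gt0.
by rewrite ltNge; apply: contra yj => dj; rewrite yJ // inE.
Qed.

End Spectral.

(** * Cuts, minimum degree and edge connectivity *)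

Section Cuts.

Variables (T : finType) (e : rel T).
Hypotheses (e_sym : symmetric e) (e_irr : irreflexive e).
Implicit Types (X Y : {set T}).

Definition cut_size X : nat := #|edges_between e X (~: X)|.

(** Each edge of the cut is counted once, oriented from X to its complement. *)
Lemma cut_sizeE X : cut_size X = \sum_(x in X) \sum_(y in ~: X) e x y.
Proof.
pose D := [set p : T * T | [&& p.1 \in X, p.2 \in ~: X & e p.1 p.2]].
have -> : cut_size X = #|(fun p : T * T => [set p.1; p.2]) @: D|.
  congr #|pred_of_set _|; apply/setP=> f; apply/imset2P/imsetP.
    case=> x y xX; rewrite inE => /andP[yX exy] ->.
    by exists (x, y) => //; rewrite inE /= xX yX.
  case=> -[x y]; rewrite inE /= => /and3P[xX yX exy] ->.
  by exists x y => //; rewrite inE yX.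
rewrite card_in_imset => [|[x y] [u v]]; last first.
  rewrite !inE /= => /and3P[xX yX _] /and3P[uX vX _] /set2_inj [[-> ->] //|[xv _]].
  by rewrite xv (negPf vX) in xX.
rewrite pair_big -sum1_card big_mkcond [RHS]big_mkcond /=.
by apply: eq_bigr => -[x y] _; rewrite !inE /=; case: (x \in X); case: (y \in X); case: (e x y).
Qed.

Lemma edgesP f : reflect (exists x y, f = [set x; y] /\ e x y) (f \in edges e).
Proof.
apply: (iffP imset2P) => [[x y _]|[x [y [-> exy]]]].
  by rewrite !inE /= => exy ->; exists x, y.
by exists x y; rewrite ?inE.
Qed.

Lemma edges2 x y : ([set x; y] \in edges e) = e x y.
Proof.
apply/edgesP/idP => [[u [v [/set2_inj [] [-> ->] //]]]|exy]; first by rewrite e_sym.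
by exists x, y.
Qed.

Lemma boundary_edges X : boundary (edges e) X = edges_between e X (~: X).
Proof.
apply/setP=> f; rewrite inE; apply/idP/imset2P; last first.
  case=> x y xX; rewrite !inE /= => /andP[yX exy] ->; rewrite edges2 exy /=.
  apply/andP; split; first by apply/set0Pn; exists x; rewrite !inE eqxx.
  by apply/subsetPn; exists y; rewrite // !inE eqxx orbT.
case/and3P=> /edgesP[x [y [-> exy]]] /set0Pn[z]; rewrite !inE => /andP[zxy zX].
case/subsetPn=> w; rewrite !inE => wxy wX.
have zw : z != w by apply: contraNneq wX => <-.
case/orP: zxy => /eqP zE; case/orP: wxy => /eqP wE; subst.
- by rewrite eqxx in zw.
- by exists x y; rewrite ?inE ?wX.
- by exists y x; rewrite ?inE ?wX ?[e y x]e_sym // setUC.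
- by rewrite eqxx in zw.
Qed.

(** Deleting the edges between X and its complement disconnects the graph. The set
    of all edges, the default of the minimum, is an edge cut as well because X
    is nonempty and proper. *)
Lemma edge_connectivity_le X :
  X != set0 -> X != [set: T] -> edge_connectivity e <= cut_size X.
Proof.
move=> /set0Pn[x xX] /eqP/setP nX.
have [y yX] : exists y, y \notin X.
  apply/existsP; rewrite -negb_forall; apply/negP=> /forallP aX; apply: nX => y.
  by rewrite aX inE.
have sep (F : {set {set T}}) : F \subset edges e ->
    edges_between e X (~: X) \subset F -> edge_cut e F.
  move=> FE sub; rewrite /edge_cut FE /=; apply/negP=> /forallP/(_ x)/forallP/(_ y).
  suff cl z : conn (edges e :\: F) x z -> z \in X by move/cl; rewrite (negPf yX).
  move: z; apply: connect_indr => // u v _ uX; rewrite adjE !inE edges2.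
  case/and3P=> _ nF euv; apply: contraNT nF => vX; apply: (subsetP sub).
  by apply/imset2P; exists u v; rewrite ?inE ?vX.
rewrite /edge_connectivity; case: arg_minnP; last first.
  move=> F _ /(_ (edges_between e X (~: X))); apply; apply: sep => //.
  by rewrite -boundary_edges; apply/subsetP=> f; rewrite inE => /andP[].
apply: sep => //; rewrite -boundary_edges.
by apply/subsetP=> f; rewrite inE => /andP[].
Qed.

Lemma min_degree_le x : min_degree e <= degree e x.
Proof.
rewrite /min_degree; have := mem_index_enum x; elim: (index_enum T) => // y s IHs.
rewrite inE big_cons => /orP[/eqP ->|/IHs]; first exact: geq_minl.
exact: leq_trans (geq_minr _ _).
Qed.

(** A nonempty set of s <= d vertices, d being the minimum degree, sends at least
    s (d + 1 - s) >= d edges outside, since each of its vertices has at most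
    s - 1 neighbours inside. *)
Lemma card_gt_min_degree X :
  X != set0 -> cut_size X < min_degree e -> min_degree e < #|X|.
Proof.
move=> X0 ltX; rewrite ltnNge; apply/negP=> leX.
have X_gt0 : 0 < #|X| by rewrite card_gt0.
move: ltX; apply/negP; rewrite -leqNgt.
apply: leq_trans (_ : #|X| * ((min_degree e).+1 - #|X|) <= _); first nia.
rewrite cut_sizeE -sum_nat_const; apply: leq_sum => x xX.
have -> : \sum_(y in ~: X) e x y = #|[set y | e x y] :\: X|.
  rewrite -sum1_card big_mkcond [RHS]big_mkcond /=; apply: eq_bigr => y _.
  by rewrite !inE; case: (y \in X); case: (e x y).
have := min_degree_le x; rewrite /degree -(cardsID X).
have : #|[set y | e x y] :&: X| < #|X|.
  apply: proper_card; apply/properP; split; first exact: subsetIr.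
  by exists x => //; rewrite !inE e_irr.
lia.
Qed.

Lemma cut_size_union X Y : cut_size (~: (X :|: Y)) <= cut_size X + cut_size Y.
Proof.
have sub : edges_between e (~: (X :|: Y)) (~: ~: (X :|: Y)) \subset
   edges_between e X (~: X) :|: edges_between e Y (~: Y).
  apply/subsetP=> f /imset2P[x y]; rewrite !inE negb_or negbK.
  case/andP=> xX xY /andP[/orP[yX|yY] exy] ->; apply/orP; [left|right];
  by apply/imset2P; exists y x; rewrite ?inE ?xX ?xY ?[e y x]e_sym // setUC.
by apply: leq_trans (subset_leq_card sub) (leq_card_setU _ _).
Qed.

End Cuts.

(** * Rayleigh quotients of the Laplacian on step functions *)

Section Rayleigh.
Local Open Scope ring_scope.

Variables (R : rcfType) (T : finType) (e : rel T).
Hypothesis e_sym : symmetric e.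

Lemma laplacian_sym : (laplacian R e)^T = laplacian R e.
Proof.
rewrite /laplacian linearB /= tr_diag_mx; congr (_ - _).
by apply/matrixP=> i j; rewrite !mxE e_sym.
Qed.

Definition vertex_row (w : T -> R) : 'rV[R]_#|T| := \row_j w (enum_val j).

Lemma sum_enum_val (f : T -> R) : \sum_(j < #|T|) f (enum_val j) = \sum_x f x.
Proof.
rewrite [RHS](reindex (enum_val : 'I_#|T| -> T)) //.
by exists enum_rank => x _; rewrite ?enum_valK ?enum_rankK.
Qed.

Lemma quad1 (w : T -> R) :
  quad 1%:M (vertex_row w) (vertex_row w) = \sum_x w x ^+ 2.
Proof.
rewrite /quad mulmx1 mxE -sum_enum_val; apply: eq_bigr => j _.
by rewrite !mxE expr2.
Qed.

Lemma quad_laplacian (w : T -> R) :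
  2 * quad (laplacian R e) (vertex_row w) (vertex_row w) =
  \sum_x \sum_y (e x y)%:R * (w x - w y) ^+ 2.
Proof.
have -> : quad (laplacian R e) (vertex_row w) (vertex_row w) =
    \sum_x \sum_y (e x y)%:R * (w x ^+ 2 - w x * w y).
  rewrite /quad /laplacian mulmxBr mulmxBl [LHS]mxE [X in _ + X]mxE.
  transitivity (\sum_x \sum_y (e x y)%:R * w x ^+ 2
                - \sum_x \sum_y (e x y)%:R * (w x * w y)); last first.
    rewrite -sumrB; apply: eq_bigr => x _; rewrite -sumrB.
    by apply: eq_bigr => y _; rewrite mulrBr.
  congr (_ - _).
    rewrite mul_mx_diag mxE -sum_enum_val; apply: eq_bigr => j _.
    rewrite !mxE /degree -mulr_suml -natr_sum.
    have -> : (\sum_(y : T) (e (enum_val j) y : nat))%N = #|[set y | e (enum_val j) y]|.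
      by rewrite -sum1_card [RHS]big_mkcond /=; apply: eq_bigr => y _; rewrite inE; case: e.
    by ring.
  rewrite mxE -sum_enum_val.
  under eq_bigr => j _ do rewrite mxE mulr_suml.
  rewrite exchange_big /=; apply: eq_bigr => i _; rewrite -sum_enum_val.
  by apply: eq_bigr => j _; rewrite !mxE; ring.
rewrite mulr_natl mulr2n.
rewrite [X in X + _]exchange_big /= -big_split /=; apply: eq_bigr => x _.
rewrite -big_split /=; apply: eq_bigr => y _; rewrite e_sym.
by ring.
Qed.

Section DisjointSets.

Variables (p : nat) (X : 'I_p -> {set T}).
Hypothesis X_disj : forall i j, i != j -> [disjoint X i & X j].

Definition step_function (c : 'rV[R]_p) (x : T) : R := \sum_i c 0 i * (x \in X i)%:R.

Lemma step_function_in c i x : x \in X i -> step_function c x = c 0 i.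
Proof.
move=> xi; rewrite /step_function (bigD1 i) //= xi mulr1 big1 ?addr0 // => j ji.
suff /negPf -> : x \notin X j by rewrite mulr0.
by apply/negP=> xj; move: (X_disj ji); rewrite disjoint_subset => /subsetP/(_ x xj);
  rewrite inE xi.
Qed.

Lemma step_function_sqr c x :
  step_function c x ^+ 2 = \sum_i c 0 i ^+ 2 * (x \in X i)%:R.
Proof.
have [/existsP[i xi]|/existsPn nx] := boolP [exists i, x \in X i].
  rewrite (step_function_in c xi) (bigD1 i) //= xi mulr1 big1 ?addr0 // => j ji.
  suff /negPf -> : x \notin X j by rewrite mulr0.
  by apply/negP=> xj; move: (X_disj ji); rewrite disjoint_subset => /subsetP/(_ x xj);
    rewrite inE xi.
rewrite /step_function !big1 ?expr0n // => i _; by rewrite (negPf (nx i)) mulr0.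
Qed.

(** The inequality (a - b)^2 <= 2 (a^2 + b^2), together with the vanishing of the
    left side when x and y lie in the same set. *)
Lemma step_function_diff c x y :
  (step_function c x - step_function c y) ^+ 2 <=
  2 * (\sum_i c 0 i ^+ 2 * ((x \in X i) && (y \notin X i))%:R +
       \sum_i c 0 i ^+ 2 * ((y \in X i) && (x \notin X i))%:R).
Proof.
have [/existsP[i /andP[xi yi]]|/existsPn nxy] := boolP [exists i, (x \in X i) && (y \in X i)].
  rewrite (step_function_in c xi) (step_function_in c yi) subrr expr0n /=.
  by rewrite mulr_ge0 // addr_ge0 // sumr_ge0 // => j _; rewrite mulr_ge0 ?sqr_ge0 ?ler0n.
have E u v : (forall i, ~~ ((u \in X i) && (v \in X i))) ->
    \sum_i c 0 i ^+ 2 * ((u \in X i) && (v \notin X i))%:R = step_function c u ^+ 2.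
  move=> n; rewrite step_function_sqr; apply: eq_bigr => i _; congr (_ * _%:R).
  by move: (n i); case: (u \in X i); case: (v \in X i).
rewrite !E // => [|i]; last by rewrite andbC.
by have := sqr_ge0 (step_function c x + step_function c y); lra.
Qed.

(** An edge contributes to the form only if it leaves some X i, and then at most
    2 c_i^2 for each X i that it leaves. *)
Lemma quad_step_le c :
  quad (laplacian R e) (vertex_row (step_function c)) (vertex_row (step_function c))
  <= 2 * \sum_i c 0 i ^+ 2 * (cut_size e (X i))%:R.
Proof.
set q := quad _ _ _; set S := \sum_i _.
have cutE : S = \sum_x \sum_y (e x y)%:R *
    \sum_i c 0 i ^+ 2 * ((x \in X i) && (y \notin X i))%:R.
  transitivity (\sum_x \sum_i \sum_y (e x y)%:R *
      (c 0 i ^+ 2 * ((x \in X i) && (y \notin X i))%:R)); last first.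
    apply: eq_bigr => x _; rewrite exchange_big; apply: eq_bigr => y _.
    by rewrite mulr_sumr.
  rewrite exchange_big /=; apply: eq_bigr => i _.
  rewrite cut_sizeE natr_sum mulr_sumr [LHS]big_mkcond /=; apply: eq_bigr => x _.
  rewrite natr_sum mulr_sumr; case: ifP => xX; last first.
    by rewrite big1 // => y _; rewrite /= !mulr0.
  rewrite big_mkcond /=; apply: eq_bigr => y _; rewrite inE.
  by case: (y \in X i) => /=; ring.
suff : 2 * q <= 4 * S by lra.
have -> : 4 * S = 2 * (S + S) by ring.
rewrite quad_laplacian {1}cutE cutE [X in _ + X]exchange_big /= -big_split mulr_sumr.
apply: ler_sum => x _; rewrite -big_split mulr_sumr; apply: ler_sum => y _ /=.
rewrite (e_sym y x) -mulrDr [leRHS]mulrCA; apply: ler_wpM2l; first exact: ler0n.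
exact: step_function_diff.
Qed.

(** Courant-Fischer applied to the span of the indicator vectors of the X i. *)
Theorem laplacian_mu_le (rho : R) : (0 < p)%N ->
  (forall i, X i != set0) ->
  (forall i, 2 * (cut_size e (X i))%:R <= rho * #|X i|%:R) ->
  laplacian_mu R e (#|T| - p).+1 <= rho.
Proof.
move=> p_gt0 X0 cutX.
pose U : 'M[R]_(p, #|T|) := \matrix_(i, j) (enum_val j \in X i)%:R.
have UE c : c *m U = vertex_row (step_function c).
  by apply/rowP=> j; rewrite !mxE; apply: eq_bigr => i _; rewrite mxE.
apply: (@spectrum_nth_le R #|T| p (laplacian R e) U) => //; first exact: laplacian_sym.
  apply: inj_row_free => c /rowP cU; apply/rowP=> i; rewrite mxE.
  have /set0Pn[x xi] := X0 i.
  by have := cU (enum_rank x); rewrite UE !mxE enum_rankK (step_function_in c xi).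
move=> c; rewrite UE; apply: le_trans (quad_step_le c) _.
rewrite quad1.
have -> : \sum_x step_function c x ^+ 2 = \sum_i c 0 i ^+ 2 * #|X i|%:R.
  under eq_bigr do rewrite step_function_sqr.
  rewrite exchange_big /=; apply: eq_bigr => i _; rewrite -mulr_sumr -natr_sum; congr (_ * _%:R).
  by rewrite -sum1_card [RHS]big_mkcond /=; apply: eq_bigr => x _; case: (x \in X i).
rewrite !mulr_sumr; apply: ler_sum => i _.
by rewrite [leLHS]mulrCA [leRHS]mulrCA; apply: ler_wpM2l; [exact: sqr_ge0 | exact: cutX].
Qed.

End DisjointSets.
End Rayleigh.

(** * Small sets and the packing *)

(** Each of the three sets has at least min_degree + 1 vertices by
    [card_gt_min_degree], which gives the denominator. *)
Lemma laplacian_mu_three_sets (R : rcfType) (T : finType) (e : rel T)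
  (e_sym : symmetric e) (e_irr : irreflexive e) (r : nat) (A B C : {set T}) :
  [/\ A != set0, B != set0 & C != set0] ->
  [/\ [disjoint A & B], [disjoint B & C] & [disjoint C & A]] ->
  [/\ cut_size e A <= r, cut_size e B <= r & cut_size e C <= r] ->
  r < min_degree e ->
  (laplacian_mu R e (#|T| - 2) <= 2 * r%:R / ((min_degree e)%:R + 1))%R.
Proof.
case=> A0 B0 C0 [dAB dBC dCA] [rA rB rC] ltr.
set d := min_degree e in ltr *.
have big Y : Y != set0 -> cut_size e Y <= r -> d < #|Y|.
  by move=> Y0 rY; apply: card_gt_min_degree => //; apply: leq_ltn_trans ltr.
pose X (i : 'I_3) := nth set0 [:: A; B; C] i.
have X0 i : X i != set0 by case: i => [[|[|[|]]]].
have Xr i : cut_size e (X i) <= r by case: i => [[|[|[|]]]].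
have Xd i j : i != j -> [disjoint X i & X j].
  by case: i j => [[|[|[|//]]] ?] [[|[|[|//]]] ?] //= _; rewrite /X //= disjoint_sym.
have n3 : (#|T| - 3).+1 = #|T| - 2.
  have : #|A| + #|B| + #|C| <= #|T|.
    rewrite -cardsUI (disjoint_setI0 dAB) cards0 addn0 -cardsUI.
    rewrite setIUl (setIC A) (disjoint_setI0 dCA) (disjoint_setI0 dBC) setU0 cards0 addn0.
    exact: max_card.
  have := big A A0 rA; have := big B B0 rB; have := big C C0 rC; lia.
rewrite -n3; apply: (laplacian_mu_le e_sym Xd) => // i.
have d0 : (0 < d%:R + 1 :> R)%R by rewrite ltr_wpDl ?ler0n.
rewrite mulrAC ler_pdivlMr // -!mulrA ler_pM2l // natr1 -!natrM ler_nat.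
have := big _ (X0 i) (Xr i); have := Xr i; nia.
Qed.

(** Here small means at most 2k + 1 cut edges. Every part has at least k + 1 of
    them, so with s small parts out of t the sum is at least
    s (k + 1) + (t - s) (2k + 2) = (k + 1) (2t - s), which is less than
    (k + 1) (2t - 2) only if s > 2. *)
Lemma three_small_parts (T : finType) (e : rel T) (e_sym : symmetric e)
  (k : nat) (Q : {set {set T}}) :
  k < edge_connectivity e -> partition Q [set: T] ->
  \sum_(X in Q) cut_size e X < 2 * (k.+1 * #|Q|.-1) ->
  2 < #|[set X in Q | cut_size e X <= (2 * k).+1]|.
Proof.
move=> kappa partQ ltQ; have [_ tQ Q0] := and3P partQ.
have Qn0 X : X \in Q -> X != set0 by move=> XQ; apply: contraNneq Q0 => <-.
have QnT X : X \in Q -> X != [set: T].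
  move=> XQ; apply/eqP => XT.
  have : 1 < #|Q| by move: ltQ; case: #|Q| => [|[|q]] //=; rewrite !muln0 ltn0.
  rewrite (cardsD1 X) XQ ltnS => /card_gt0P[Y]; rewrite !inE => /andP[YX YQ].
  have /trivIsetP/(_ Y X YQ XQ YX) := tQ.
  by rewrite XT -setI_eq0 setIT (negPf (Qn0 Y YQ)).
pose small X := cut_size e X <= (2 * k).+1.
change (2 < #|[set X in Q | small X]|).
move: ltQ; rewrite (bigID small) /=.
have h1 : #|[set X in Q | small X]| * k.+1 <= \sum_(X in Q | small X) cut_size e X.
  rewrite -sum_nat_const big_mkcond [leqRHS]big_mkcond; apply: leq_sum => X _.
  rewrite inE; case: ifP => // /andP[XQ _].
  exact: leq_trans kappa (edge_connectivity_le e_sym (Qn0 _ XQ) (QnT _ XQ)).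
have h2 : #|[set X in Q | ~~ small X]| * (2 * k.+1) <= \sum_(X in Q | ~~ small X) cut_size e X.
  rewrite -sum_nat_const big_mkcond [leqRHS]big_mkcond; apply: leq_sum => X _.
  by rewrite inE; case: ifP => // /andP[XQ]; rewrite /small; lia.
have : #|[set X in Q | small X]| + #|[set X in Q | ~~ small X]| = #|Q|.
  rewrite -[RHS](cardsID [set X | small X]); congr (_ + _); apply: eq_card => X;
  by rewrite !inE // andbC.
move: h1 h2; move: (\sum_(X in Q | small X) _) (\sum_(X in Q | ~~ small X) _).
move: #|[set X in Q | small X]| #|[set X in Q | ~~ small X]| #|Q| => s s' t a b h1 h2 st lt.
have : k.+1 * (s + 2 * s') < k.+1 * (2 * t.-1) by lia.
by rewrite ltn_pmul2l //; lia.
Qed.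

Theorem theorem1p2 (R : rcfType) (T : finType) (e : rel T)
  (e_sym : symmetric e) (e_irr : irreflexive e)
  (n k delta : nat) (card_T : #|T| = n) (k_ge2 : 2 <= k)
  (G1 : in_G e 1)
  (deltaE : min_degree e = delta) (delta_ge : 2 * k + 2 <= delta)
  (mu_gt : ((16%:R * (k%:R + (delta%:R - 1) / delta%:R)) / (3%:R * (delta%:R + 1))
            < laplacian_mu R e (n - 2))%R) :
  property_P e k delta.
Proof.
have no_three (A B C : {set T}) :
    [/\ A != set0, B != set0 & C != set0] ->
    [/\ [disjoint A & B], [disjoint B & C] & [disjoint C & A]] ->
    ~ [/\ cut_size e A <= (2 * k).+1, cut_size e B <= (2 * k).+1
        & cut_size e C <= (2 * k).+1].
  move=> ABC0 dABC cABC.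
  have := laplacian_mu_three_sets R e_sym e_irr ABC0 dABC cABC.
  rewrite deltaE card_T => /(_ _)/(lt_le_trans mu_gt) lt; have {lt}/lt : (2 * k).+1 < delta by lia.
  apply/negP; rewrite -leNgt.
  have d0 : (6 <= delta%:R :> R)%R by rewrite (ler_nat _ 6); lia.
  have k0 : (2 <= k%:R :> R)%R by rewrite (ler_nat _ 2).
  have q_ge : (5 / 6 <= (delta%:R - 1) / delta%:R :> R)%R.
    by rewrite ler_pdivlMr; lra.
  rewrite invfM mulrA; apply: ler_wpM2r; first by rewrite invr_ge0; lra.
  have -> : ((2 * k).+1%:R = 2 * k%:R + 1 :> R)%R by rewrite -natr1 natrM.
  lra.
have [V [Vprop Vdisj Vrest Vcut]] := G1.
have T_gt0 : 0 < #|T|.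
  by have /set0Pn[x _] := Vrest; apply/card_gt0P; exists x.
have cutQ Q : partition Q [set: T] ->
    2 * (k.+1 * #|Q|.-1) <= \sum_(X in Q) #|boundary (edges e) X|.
  move=> partQ; rewrite leqNgt; apply/negP.
  under eq_bigr => X _ do rewrite (boundary_edges e_sym) -/(cut_size e X).
  move=> ltQ; have [kappa|kappa] := leqP (edge_connectivity e) k.
    have V0 := (Vprop ord0).1; have V1 := (Vprop ord_max).1.
    have d01 : [disjoint V ord0 & V ord_max] by exact: Vdisj.
    move: Vrest; rewrite big_ord_recl big_ord1 => V2.
    rewrite (_ : lift ord0 ord0 = ord_max) in V2; last exact: val_inj.
    have c0 : cut_size e (V ord0) <= k by rewrite /cut_size -Vcut.
    have c1 : cut_size e (V ord_max) <= k by rewrite /cut_size -Vcut.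
    have c2 := cut_size_union e_sym (V ord0) (V ord_max).
    apply: (no_three (V ord0) (V ord_max) (~: (V ord0 :|: V ord_max))) => //; last by split; lia.
    split=> //; rewrite disjoint_subset; apply/subsetP => x; rewrite !inE.
      by move=> ->; rewrite orbT.
    by rewrite negb_or => /andP[].
  have /card_gt2P[A [B [C [[]]]]] := three_small_parts e_sym kappa partQ ltQ.
  rewrite !inE => /andP[AQ cA] /andP[BQ cB] /andP[CQ cC] [nAB nBC nCA].
  have [_ /trivIsetP tQ Q0] := and3P partQ.
  apply: (no_three A B C) => //; last by split; apply: tQ.
  by split; apply: contraNneq Q0 => <-.
have edgeP f : f \in edges e -> exists x y, f = [set x; y].
  by case/edgesP=> x [y [-> _]]; exists x, y.
have [F [FE Ftree Fcard Fdisj]] := nash_williams_tutte edgeP cutQ T_gt0.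
exists (fun i => F (lift ord0 i)), (F ord0); split=> //.
- by move=> i j ij; apply: Fdisj; rewrite (inj_eq lift_inj).
- split=> //; first by case: (Ftree ord0).
    by move=> i; apply: Fdisj.
  have n_gt1 : 1 < #|T|.
    have [V0 /proper_card] := Vprop ord0; rewrite cardsT.
    by apply: leq_ltn_trans; rewrite card_gt0.
  have d0 : (0 < delta%:R :> rat)%R by rewrite ltr0n; lia.
  have -> : (#|T|%:R - 1 = #|F ord0|%:R :> rat)%R by rewrite -(Fcard ord0) -natr1 addrK.
  rewrite mulrAC ltr_pdivrMr // mulrC ltr_pM2l ?ltrBlDr ?ltrDl //.
  by rewrite ltr0n; have := Fcard ord0; lia.
Qed.
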